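(* Let $\phi$ be Euler's totient function and let $g(n) = n + \phi(n)$ for $n \in \mathbb{N}$, with iterates $g_k$ ($g_0(n) = n$ and $g_k(n) = g(g_{k-1}(n))$ for $k \ge 1$). (A) The problem of finding those $n$ for which $g_{k+2}(n) = 2 g_k(n)$ for all large $k$ is equivalent to finding solutions of $\phi(m) + \phi(m+\phi(m)) = m$, in the following sense: for every positive integer $n$, one has $g_{k+2}(n) = 2 g_k(n)$ for all sufficiently large $k$ if and only if there exists an integer $k \ge 0$ such that $m = g_k(n)$ satisfies $$\phi(m) + \phi(m + \phi(m)) = m.$$ (B) If a positive integer $n$ satisfies $\phi(n) + \phi(n+\phi(n)) = n$, then there exists an integer $\ell \ge 1$ such that at least one of the following holds: (1) $n \in \{2^{\ell}\cdot 1,\ 2^{\ell}\cdot 3,\ 2^{\ell}\cdot 5,\ 2^{\ell}\cdot 7,\ 2^{\ell}\cdot 35,\ 2^{\ell}\cdot 47\}$; (2) there exists an integer $m \ge 0$ such that $8m+7$ is a prime number with $8m+7 \ge 10^{10}$, $\phi(6m+5) = 4m+4$, and $n = 2^{\ell}(8m+7)$ or $n = 2^{\ell}(6m+5)$.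
   Context: $\mathbb{N}$ denotes the positive integers. Euler's totient function $\phi(n)$ counts the integers in $\{1,\dots,n\}$ coprime to $n$ (so $\phi(1)=1$). The function $g:\mathbb{N}\to\mathbb{N}$ is $g(n)=n+\phi(n)$ and $g_k$ is its $k$-fold iterate, with $g_1 = g$ and $g_0(n)=n$. *)

(* Defs.v *)
From mathcomp Require Import all_boot.

Set Implicit Arguments.
Unset Strict Implicit.
Unset Printing Implicit Defensive.

Definition g (n : nat) : nat := n + totient n.

(* The [k]-th iterate of [g] at [n] is [iter k g n]. *)

(* Main.v *)
Require Import Defs.
From Stdlib Require Import BinNat Nnat.
From mathcomp Require Import all_boot zify.

(** A solution [n] is even, so [phi(2n) = 2 phi(n)] and [g n] is again a
    solution; this gives (A). For (B), write [n = 2^l q] and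
    [q + phi(q)/2 = 2^s r] with [q], [r] odd; the equation becomes
    [phi(q) + 2^s phi(r) = 2q]. If [s = 0] then [4] does not divide [phi(r)],
    and if [s > 0] then [4] does not divide [phi(q)], so one of [q], [r] is a
    power of an odd prime [p]. Comparing both sides forces the exponent to be 1,
    and, apart from [p = 3], [p = 8m+7] while the other number is [6m+5], with
    [3 phi(6m+5) = 2 (6m+5) + 2].
    The solutions of [3 phi(r) = 2r + 2] up to [7.5 * 10^9] are found by a search
    over the increasing sequences of prime factors of the squarefree number [r]:
    they are [5], [35], [1295], [1679615], and the last two correspond to
    [8m+7 = 11 * 157] and [8m+7 = 23 * 97369]. *)

Set Implicit Arguments.
Unset Strict Implicit.
Unset Printing Implicit Defensive.

(** * The search for solutions of [3 phi(r) = 2r + 2] *)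

(** Only a proper divisor counts, so the listed primes themselves pass. *)
Definition small_factor (n : N) : bool :=
  has (fun d => if (n mod d =? 0)%num then (d <? n)%num else false)
    [:: 2; 3; 5; 7; 11; 13; 17; 19; 23]%num.

#[local] Arguments N.add : simpl never.
#[local] Arguments N.mul : simpl never.
#[local] Arguments N.sub : simpl never.

Lemma small_factor_prime p : prime p -> small_factor (N.of_nat p) = false.
Proof.
move=> p_pr; apply/negP => /hasP[d d_in]; case: N.eqb_spec => // dvd_dp ltdp.
have [c def_p] := proj1 (N.Lcm0.mod_divide _ _) dvd_dp.
have dvdp: N.to_nat d %| p by apply/dvdnP; exists (N.to_nat c); lia.
have d1: (1 <? d)%num by apply: (allP _ _ d_in).
by case/primeP: p_pr => _ /(_ _ dvdp); lia.
Qed.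

(* Starting from [Q = P * b], success certifies [M * n < L * phi(n)] for every
   squarefree [n <= B / P] with all prime factors at least [b]: such an [n] has
   at most [j] of them if [B < P * b^(j+1)], so [phi(n) / n >= (1 - 1/b)^j]. *)
Fixpoint totient_gap (B : N) (fuel : nat) (L M Q b : N) : bool :=
  if fuel is fuel'.+1 then
    if (B <? Q)%num then (M <? L)%num
    else totient_gap B fuel' (L * (b - 1)) (M * b) (Q * b) b
  else false.

Definition known_solution (n : N) : bool :=
  n \in [:: 5; 35; 1295; 1679615]%num.

(* [P] is the product of the prime factors of [r] chosen so far and [F = phi(P)];
   the remaining ones are at least [b]. With [r = P * n], each prime factor [p]
   of [n] satisfies [3 F < p D], and if [n] is itself prime then
   [n = (3 F + 2) / D]. Composite values of [b] that [small_factor] misses only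
   add useless branches. *)
Fixpoint search (B : N) (fuel : nat) (P F b : N) : bool :=
  if fuel is fuel'.+1 then
    let D := (3 * F - 2 * P)%num in
    if (D =? 2)%num && ~~ known_solution P then false
    else if (D =? 0)%num then true
    else
      let c := if (b * D <=? 3 * F)%num then (3 * F / D + 1)%num else b in
      if (B <? P * c * c)%num then
        let q := ((3 * F + 2) / D)%num in
        if (q * D =? 3 * F + 2)%num then
          [|| (q <? c)%num, small_factor q | (B <? P * q)%num]
        else true
      else if small_factor c then search B fuel' P F (c + 1)
      else if totient_gap B fuel' (3 * F) (2 * P + 1) (P * c) c then true
      else if search B fuel' P F (c + 1) then
        search B fuel' (P * c) (F * (c - 1)) (c + 1)
      else false
  else false.

(** * Soundness of the search *)

Lemma ltN_mul_cancel (a b x y : N) : (a * x < b * y -> y <= x -> a < b)%num.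
Proof.
move=> lt_ab le_yx; case: (N.lt_ge_cases a b) => // le_ba.
by have := N.mul_le_mono _ _ _ _ le_ba le_yx; lia.
Qed.

Definition squarefree (n : nat) : Prop := forall p, prime p -> ~~ (p * p %| n).

Lemma squarefree_prime_dvd p n : prime p -> 0 < n -> squarefree n -> p %| n ->
  exists m, [/\ n = p * m, 0 < m, ~~ (p %| m), squarefree m
    & totient n = p.-1 * totient m].
Proof.
move=> p_pr n_gt0 sqf_n /dvdnP[m def_n]; rewrite {}def_n in n_gt0 sqf_n *.
have m_gt0: 0 < m by case: (m) n_gt0.
have p'm: ~~ (p %| m).
  by apply: contra (sqf_n p p_pr) => p_m; rewrite dvdn_mul.
exists m; rewrite [m * p]mulnC; split=> // [q q_pr|].
  by apply: contra (sqf_n q q_pr) => /dvdn_trans-> //; apply: dvdn_mulr.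
by rewrite totient_coprime ?prime_coprime // totient_prime.
Qed.

(** Each round removes a prime [p >= b] from [n] and multiplies [Q] by [b], which preserves
    [Q n <= B b]; the bound survives since [(p-1)/p >= (b-1)/b]. Once [B < Q], only [n = 1] is
    left. *)
Lemma totient_gapP B fuel L M Q b n :
    (0 < b)%num -> totient_gap B fuel L M Q b ->
    0 < n -> squarefree n ->
    (forall p, prime p -> p %| n -> (b <= N.of_nat p)%num) ->
    (Q * N.of_nat n <= B * b)%num ->
  (M * N.of_nat n < L * N.of_nat (totient n))%num.
Proof.
move=> b_gt0; elim: fuel L M Q n => //= fuel IHfuel L M Q n.
have [n_gt1|n_le1] := ltnP 1 n; last first.
  move=> + n_gt0; have -> : n = 1 by lia.
  case: N.ltb_spec => [_|leQ] gap sqf1 _ leQn; first by change (totient 1) with 1; lia.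
  (* For [n = 1] further rounds only strengthen the inequality. *)
  have: (M * b * N.of_nat 1 < L * (b - 1) * N.of_nat (totient 1))%num.
    apply: (IHfuel _ _ _ 1 gap isT sqf1); last by nia.
    by move=> p p_pr; rewrite dvdn1 => /eqP p1; rewrite p1 in p_pr.
  by change (totient 1) with 1; nia.
move=> + n_gt0 sqf_n le_b leQn; have p_pr := pdiv_prime n_gt1.
have p_n := pdiv_dvd n; set p := pdiv n in p_pr p_n *.
have le_bp := le_b p p_pr p_n.
have [m [def_n m_gt0 _ sqf_m ->]] := squarefree_prime_dvd p_pr n_gt0 sqf_n p_n.
have leQm : (Q * b * N.of_nat m <= B * b)%num.
  apply: N.le_trans leQn; rewrite def_n Nat2N.inj_mul -N.mul_assoc.
  exact/N.mul_le_mono_l/N.mul_le_mono_r.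
case: N.ltb_spec => [ltQ|_] gap.
  have := proj1 (N.mul_lt_mono_pos_r b _ _ b_gt0) ltQ.
  have : (Q * b * 1 <= Q * b * N.of_nat m)%num by apply: N.mul_le_mono_l; lia.
  lia.
have le_bm q (q_pr : prime q) (q_m : q %| m) : (b <= N.of_nat q)%num.
  by apply: le_b => //; rewrite def_n dvdn_mull.
have lt_m := IHfuel _ _ _ m gap m_gt0 sqf_m le_bm leQm.
rewrite def_n !Nat2N.inj_mul.
have -> : N.of_nat p.-1 = (N.of_nat p - 1)%num by lia.
move: (N.of_nat p) (N.of_nat m) (N.of_nat (totient m)) le_bp lt_m.
move=> x y t le_bx lt_y.
suff: (M * (x * y) * b < L * ((x - 1) * t) * b)%num.
  exact: (proj2 (N.mul_lt_mono_pos_r b _ _ b_gt0)).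
have le1: (x * (L * (b - 1) * t) <= L * ((x - 1) * t) * b)%num.
  have -> : (x * (L * (b - 1) * t) = L * t * (x * (b - 1)))%num by lia.
  have -> : (L * ((x - 1) * t) * b = L * t * ((x - 1) * b))%num by lia.
  by apply: N.mul_le_mono_l; nia.
apply: N.lt_le_trans le1.
have -> : (M * (x * y) * b = x * (M * b * y))%num by lia.
by apply: (proj1 (N.mul_lt_mono_pos_l x _ _ _)) => //; lia.
Qed.

Lemma totient_leq n : totient n <= n.
Proof.
rewrite totient_count_coprime -[n in _ <= n]subn0 -[n - 0]muln1 -sum_nat_const_nat.
by apply: leq_sum => d _; apply: leq_b1.
Qed.

Lemma searchP B fuel P F b n :
    search B fuel P F b -> (0 < P)%num -> (0 < b)%num ->
    0 < n -> squarefree n ->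
    (forall p, prime p -> p %| n -> (b <= N.of_nat p)%num) ->
    (P * N.of_nat n <= B)%num ->
    (3 * F * N.of_nat (totient n) = 2 * (P * N.of_nat n + 1))%num ->
  known_solution (P * N.of_nat n).
Proof.
elim: fuel P F b n => //= fuel IHfuel P F b n.
set D := (3 * F - 2 * P)%num; set c := (if (b * D <=? _)%num then _ else b).
move=> + P_gt0 b_gt0 n_gt0 sqf_n le_b leB Eqn.
case: ifPn => // not_new.
have [n_gt1|n_le1] := ltnP 1 n; last first.
  have n1 : n = 1 by lia.
  move: Eqn not_new; rewrite n1; change (totient 1) with 1 => Eqn.
  by rewrite N.mul_1_r; case: N.eqb_spec => [_ /negbNE|] //; rewrite /D; lia.
have F_P : (2 * P * N.of_nat n < 3 * F * N.of_nat (totient n))%num by lia.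
have D_gt0 : (0 < D)%num.
  have: (2 * P < 3 * F)%num by apply: ltN_mul_cancel F_P _; have := totient_leq n; lia.
  by rewrite /D; lia.
(* Writing [n = p m] and using [phi(m) <= m] gives [2 P p < 3 F (p - 1)]. *)
have lt_p p : prime p -> p %| n -> (3 * F < N.of_nat p * D)%num.
  move=> p_pr p_n.
  have [m [def_n m_gt0 _ _ def_t]] :=
    squarefree_prime_dvd p_pr n_gt0 sqf_n p_n.
  have lt_p1 : (2 * P * N.of_nat p < 3 * F * (N.of_nat p - 1))%num.
    apply: (@ltN_mul_cancel _ _ (N.of_nat m) (N.of_nat (totient m))).
      by move: F_P; rewrite def_t def_n; nia.
    by have := totient_leq m; lia.
  by move: lt_p1; rewrite /D !N.mul_sub_distr_l; lia.
have c_gt0 : (0 < c)%num.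
  by rewrite /c; case: ifP => // _; rewrite N.add_1_r; apply: N.lt_0_succ.
have le_c p : prime p -> p %| n -> (c <= N.of_nat p)%num.
  move=> p_pr p_n; rewrite /c; case: ifP => _; last exact: le_b.
  have := lt_p p p_pr p_n; rewrite [(_ * D)%num]N.mul_comm => /N.Div0.div_lt_upper_bound.
  by move: (3 * F / D)%num => q; lia.
case: (N.eqb_spec D 0) => [D0|_]; first by rewrite D0 in D_gt0.
(* Here [n < c^2] and all its prime factors are at least [c], so [n] is prime and the equation
   determines it. *)
case: N.ltb_spec => [ltB|_].
  have n_pr : prime n.
    apply: ltn_pdiv2_prime => //; have := le_c _ (pdiv_prime n_gt1) (pdiv_dvd n).
    rewrite -mulnn; move: (pdiv n) => p le_cp.
    have: (N.of_nat n < c * c)%num.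
      by apply: (proj2 (N.mul_lt_mono_pos_l P _ _ P_gt0)); lia.
    by have := N.mul_le_mono _ _ _ _ le_cp le_cp; lia.
  have def_q : (3 * F + 2 = N.of_nat n * D)%num.
    by move: Eqn; rewrite totient_prime // /D; nia.
  rewrite def_q N.div_mul; last lia.
  rewrite N.eqb_refl small_factor_prime //.
  have := le_c n n_pr (dvdnn n); lia.
have step b' : (c < b')%num -> search B fuel P F b' ->
    (forall p, prime p -> p %| n -> (b' <= N.of_nat p)%num) -> 
    known_solution (P * N.of_nat n).
  by move=> ltcb src le_b'; apply: IHfuel src _ _ _ _ le_b' _ Eqn => //; lia.
have lt_c p : prime p -> p %| n -> p != N.to_nat c -> (c + 1 <= N.of_nat p)%num.
  by move=> p_pr /(le_c p p_pr); lia.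
case: ifPn => [sf_c src|_].
  apply: step src _; first lia.
  move=> p p_pr p_n; apply: lt_c => //; apply: contraTneq sf_c => def_p.
  by rewrite -[c]N2Nat.id -def_p small_factor_prime.
case: ifP => [gap _|_].
  (* The gap gives [(2P + 1) n < 3 F phi(n) = 2 P n + 2], against [n > 1]. *)
  by have := totient_gapP c_gt0 gap n_gt0 sqf_n le_c; nia.
case: ifP => // src1 src2.
have [/andP[c_pr c_n]|not_c] :=
  boolP (prime (N.to_nat c) && (N.to_nat c %| n)); last first.
  apply: step src1 _; first lia.
  move=> p p_pr p_n; apply: lt_c => //; apply: contra not_c => /eqP <-.
  by rewrite p_pr.
have [m [def_n m_gt0 c'm sqf_m def_t]] :=
  squarefree_prime_dvd c_pr n_gt0 sqf_n c_n.
have def_nc : N.of_nat n = (c * N.of_nat m)%num by lia.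
rewrite def_nc N.mul_assoc; apply: IHfuel src2 _ _ m_gt0 sqf_m _ _ _.
- exact: N.mul_pos_pos.
- lia.
- move=> p p_pr p_m; apply: lt_c => //; first by rewrite def_n dvdn_mull.
  by apply: contraNneq c'm => <-.
- by rewrite -N.mul_assoc -def_nc.
move: Eqn; rewrite def_nc def_t Nat2N.inj_mul.
have -> : N.of_nat (N.to_nat c).-1 = (c - 1)%num by lia.
by lia.
Qed.

(** * Parity and prime-power factors of totients *)

Lemma totient_split p n : prime p -> 0 < n -> p %| n ->
  exists e m, [/\ n = p ^ e.+1 * m, 0 < m, ~~ (p %| m)
    & totient n = p ^ e * p.-1 * totient m].
Proof.
move=> p_pr n_gt0 p_n; have [m co_pm def_n] := pfactor_coprime p_pr n_gt0.
have := logn_gt0 p n; rewrite mem_primes p_pr n_gt0 p_n.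
case: (logn p n) def_n => // e def_n _; exists e, m; split.
- by rewrite mulnC.
- by case: m def_n n_gt0 {co_pm} => // ->.
- by rewrite -prime_coprime.
rewrite def_n totient_coprime ?coprimeXr 1?coprime_sym // totient_pfactor //=.
by rewrite mulnC [_ * p ^ e]mulnC.
Qed.

Lemma totient_pow2 e n : odd n -> totient (2 ^ e.+1 * n) = 2 ^ e * totient n.
Proof.
move=> odd_n; rewrite totient_coprime ?coprimeXl ?coprime2n //.
by rewrite totient_pfactor // mul1n.
Qed.

Lemma even_split n : 0 < n -> ~~ odd n -> exists e m, n = 2 ^ e.+1 * m /\ odd m.
Proof.
move=> n_gt0 even_n; have [|e [m [-> _ odd_m _]]] := @totient_split 2 n isT n_gt0.
  by rewrite dvdn2.
by exists e, m; split=> //; rewrite dvdn2 negbK in odd_m.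
Qed.

Lemma odd_totient n : odd n -> 1 < n -> ~~ odd (totient n).
Proof.
move=> odd_n n_gt1; have p_pr := pdiv_prime n_gt1; have p_n := pdiv_dvd n.
have [e [m [_ _ _ ->]]] := totient_split p_pr (ltnW n_gt1) p_n.
have := dvdn_odd p_n odd_n; rewrite !oddM => odd_p.
by have ->: odd (pdiv n).-1 = false; [have := prime_gt0 p_pr; lia | rewrite andbF].
Qed.

(** With [n = p^(e+1) m] and [m > 1], both [p - 1] and [phi(m)] would be even. *)
Lemma odd_totient_mod4 n : odd n -> 1 < n -> ~~ (4 %| totient n) ->
  exists p e, [/\ prime p, odd p, n = p * p ^ e & totient n = p ^ e * p.-1].
Proof.
move=> odd_n n_gt1; have p_pr := pdiv_prime n_gt1; have p_n := pdiv_dvd n.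
have odd_p := dvdn_odd p_n odd_n.
have [e [m [def_n m_gt0 _ ->]]] := totient_split p_pr (ltnW n_gt1) p_n.
have [m_le1 _|m_gt1] := leqP m 1.
  have m1: m = 1 by lia.
  by exists (pdiv n), e; rewrite p_pr odd_p {1}def_n m1 expnS !muln1.
have odd_m: odd m by move: odd_n; rewrite def_n oddM => /andP[].
case/negP; rewrite (_ : 4 = 2 * 2) // dvdn_mul ?dvdn2 ?odd_totient //.
by rewrite oddM negb_and; have := prime_gt0 p_pr; lia.
Qed.

Lemma totient_even_leq n : ~~ odd n -> 2 * totient n <= n.
Proof.
case: (posnP n) => [-> //|n_gt0] even_n.
have [e [m [-> odd_m]]] := even_split n_gt0 even_n.
by rewrite totient_pow2 // expnS -mulnA !leq_mul // totient_leq.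
Qed.

Lemma totient_double n : ~~ odd n -> totient (2 * n) = 2 * totient n.
Proof.
case: (posnP n) => [-> //|n_gt0] even_n.
have [e [m [-> odd_m]]] := even_split n_gt0 even_n.
by rewrite mulnA -expnS !totient_pow2 // expnS mulnA.
Qed.

(** If [p^2] divides [n], then [p] divides [n] and [phi(n)], hence [2]; but an even [n] has
    [phi(n) <= n/2], too small. *)
Lemma three_totient_squarefree n : 3 * totient n = 2 * n + 2 -> squarefree n.
Proof.
move=> Eqn p p_pr; apply/negP => /dvdnP[k def_n].
have n_gt0: 0 < n by case: (n) Eqn.
have p_n: p %| n by rewrite def_n mulnA dvdn_mull.
have p_t: p %| totient n.
  have [[|e] [m [def_n' _ p'm ->]]] := totient_split p_pr n_gt0 p_n.
    case/negP: p'm; apply/dvdnP; exists k; apply/eqP.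
    rewrite -(eqn_pmul2l (prime_gt0 p_pr)) -[p in p * m]expn1 -def_n' def_n.
    by lia.
  by rewrite expnS -!mulnA dvdn_mulr.
have : p %| 2 by rewrite -(dvdn_addr 2 (dvdn_mull 2 p_n)) -Eqn dvdn_mull.
rewrite dvdn_prime2 // => /eqP p2.
have := @totient_even_leq n; rewrite -dvdn2 -p2 p_n; lia.
Qed.

(** * Classification of the solutions *)

(** The two equations are what remains when one of the odd parts is [p^(e+1)] and the other is [r],
    after eliminating [h = phi(q)/2]. *)
Lemma prime_power_case p e s r : prime p -> odd p -> odd r -> 0 < s ->
    2 ^ s.+1 * r + p ^ e = 3 * p * p ^ e -> 2 ^ s * totient r = p ^ e * p.+1 ->
  e = 0 /\ (p = 3 \/ exists m, [/\ p = 8 * m + 7, r = 6 * m + 5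
                                & totient r = 4 * m + 4]).
Proof.
move=> p_pr odd_p odd_r s_gt0 Eqr Eqt; have r_gt0: 0 < r by case: (r) odd_r.
have p_gt2 := odd_prime_gt2 odd_p p_pr.
(* For a positive exponent, [p] divides [r], so [p - 1] divides [phi(r)] and then [p + 1]. Hence
   [p = 3] and [phi(r) = r], impossible by parity. *)
case: e => [|e] in Eqr Eqt *; last first.
  have co_p2: coprime p 2 by rewrite prime_coprime // dvdn_prime2 //; lia.
  have p_r: p %| r.
    rewrite -(@Gauss_dvdr _ (2 ^ s.+1)) ?coprimeXr //.
    by rewrite -(@dvdn_addl (p ^ e.+1) p) ?dvdn_exp // Eqr mulnAC dvdn_mull.
  have [f [m [_ m_gt0 _ def_t]]] := totient_split p_pr r_gt0 p_r.
  have: p.-1 %| p.+1.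
    rewrite -(@Gauss_dvdr _ (p ^ e.+1)) -?Eqt ?def_t.
      by rewrite mulnCA dvdn_mulr // dvdn_mull.
    by rewrite coprimeXr // -{2}[p]prednK ?prime_gt0 // coprimenS.
  have -> : p.+1 = p.-1 + 2 by lia.
  rewrite dvdn_addr // => /dvdn_leq p3; have {p3} p3: p = 3 by lia.
  have: totient r = r.
    apply/eqP; rewrite -(eqn_pmul2l (expn_gt0 2 s)); apply/eqP.
    by move: Eqr Eqt; rewrite p3 expnS; lia.
  have := odd_totient odd_r; have := dvdn_leq r_gt0 p_r; lia.
split=> //; move: Eqr Eqt; rewrite !muln1 mul1n.
(* For [s = 1], [3p = 4r + 1] with [r] odd forces [p = 7] modulo 8. For [s = 2], [phi(r)] is odd, so
   [r = 1]. For [s >= 3], [3(p + 1) = 2^(s+1) r + 4] fails modulo 8. *)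
case: s s_gt0 => [//|[|[|s]]] _ Eqr Eqt.
- by right; exists (p %/ 8); split; lia.
- left; have := odd_totient odd_r; lia.
by rewrite !expnS in Eqr Eqt; move: (2 ^ s) Eqr Eqt => u; nia.
Qed.

(** For odd [n > 1] both totients on the left are even. *)
Lemma solution_even n :
  0 < n -> totient n + totient (n + totient n) = n -> ~~ odd n.
Proof.
move=> n_gt0 Eqn; apply/negP => odd_n; have [n_gt1|n_le1] := ltnP 1 n.
  have even_t := odd_totient odd_n n_gt1.
  have := @odd_totient (n + totient n); lia.
by move: Eqn; have -> : n = 1 by lia.
Qed.

(** The equation says [g (g n) = 2n], and [phi(2n) = 2 phi(n)] because [n] is even. *)
Lemma g_solution n : 0 < n -> totient n + totient (n + totient n) = n ->
  totient (g n) + totient (g n + totient (g n)) = g n.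
Proof.
move=> n_gt0 Eqn; rewrite /g (_ : n + _ + _ = 2 * n); last lia.
by rewrite totient_double ?solution_even //; lia.
Qed.

Lemma solution_classification n :
    0 < n -> totient n + totient (n + totient n) = n ->
  exists l, 0 < l /\ (n = 2 ^ l \/ n = 2 ^ l * 3 \/
    exists m, [/\ prime (8 * m + 7), totient (6 * m + 5) = 4 * m + 4
                & n = 2 ^ l * (8 * m + 7) \/ n = 2 ^ l * (6 * m + 5)]).
Proof.
move=> n_gt0 Eqn.
have [e [q [def_n odd_q]]] := even_split n_gt0 (solution_even n_gt0 Eqn).
exists e.+1; split=> //.
have [q_le1|q_gt1] := leqP q 1; first by left; rewrite def_n (_ : q = 1) ?muln1; lia.
right; have even_t := odd_totient odd_q q_gt1.
set h := (totient q)./2; have def_t : totient q = 2 * h by lia.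
have h_gt0 : 0 < h by have := totient_gt0 q; lia.
have [s [r [def_qh odd_r]]] : exists s r, q + h = 2 ^ s * r /\ odd r.
  have [odd_qh|even_qh] := boolP (odd (q + h)); first by exists 0, (q + h); rewrite mul1n.
  by have [|s [r []]] := even_split _ even_qh; [lia | exists s.+1, r].
have Eqh : 2 * h + 2 ^ s * totient r = 2 * q.
  have e_gt0: 0 < 2 ^ e by rewrite expn_gt0.
  apply/eqP; rewrite -(eqn_pmul2l e_gt0); apply/eqP.
  move: Eqn; rewrite def_n totient_pow2 // def_t.
  rewrite (_ : 2 ^ e.+1 * q + 2 ^ e * (2 * h) = 2 ^ (e + s).+1 * r).
    by rewrite totient_pow2 // expnD expnS; lia.
  rewrite (_ : 2 ^ (e + s).+1 * r = 2 ^ e.+1 * (2 ^ s * r)).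
    by rewrite -def_qh expnS; lia.
  by rewrite !expnS expnD; lia.
case: s => [|s] in def_qh Eqh *.
  (* Here [phi(r) = 2(q - h)] with [q - h] odd. *)
  rewrite !mul1n in def_qh Eqh.
  have [||p [a [p_pr odd_p def_r def_tr]]] := @odd_totient_mod4 r odd_r; try lia.
  have p_gt0 := prime_gt0 p_pr.
  (* Now [r] is the prime power and [q] the other number: [4q = 2r + phi(r)] and
     [2 phi(q) = 2r - phi(r)]. *)
  have := @prime_power_case p a 1 q p_pr odd_p odd_q isT.
  case; [by nia | by nia |] => a0 [p3|[m [def_p def_q def_tq]]].
    by move: def_r; rewrite a0 p3; lia.
  by right; exists m; rewrite -def_p -def_q; split=> //; right.
(* Since [q + h] is even, [h] is odd and [phi(q) = 2h]. *)
have [|p [a [p_pr odd_p def_q def_tq]]] := @odd_totient_mod4 q odd_q q_gt1.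
  by move: def_qh; rewrite expnS; lia.
have p_gt0 := prime_gt0 p_pr.
have := @prime_power_case p a s.+1 r p_pr odd_p odd_r isT.
case; [by rewrite expnS; nia | by nia |] => a0.
have qp: q = p by rewrite def_q a0 muln1.
move=> [p3|[m [def_p def_r def_tr]]]; first by left; rewrite def_n qp p3.
by right; exists m; rewrite -def_p -def_r -qp; split=> //; [rewrite qp | left].
Qed.

(** * The computation and the conclusion *)

(** If [p = 8m + 7 < 10^10], then [6m + 5 = (3p - 1)/4] is below [7.5 * 10^9]. The fuel bounds only
    the depth of the recursion. *)
Lemma search_true : search 7500000000 (100 * 1000) 1 1 2.
Proof. by vm_compute. Qed.

Lemma three_totient_solutions n :
    3 * totient n = 2 * n + 2 -> (N.of_nat n <= 7500000000)%num ->
  known_solution (N.of_nat n).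
Proof.
move=> Eqn leB; rewrite -[N.of_nat n]N.mul_1_l.
apply: (searchP search_true) => //; try lia.
- exact: three_totient_squarefree.
by move=> p /prime_gt1; lia.
Qed.

Lemma small_classification m :
    prime (8 * m + 7) -> totient (6 * m + 5) = 4 * m + 4 -> 8 * m + 7 < 10 ^ 10 ->
  m = 0 \/ m = 5.
Proof.
move=> p_pr def_t lt_p.
have Eqn : 3 * totient (6 * m + 5) = 2 * (6 * m + 5) + 2 by lia.
have := three_totient_solutions Eqn; rewrite /known_solution !inE.
case/(_ _)/or4P => [|/eqP|/eqP|/eqP def_r|/eqP def_r]; try lia.
  have := small_factor_prime p_pr.
  by have -> : N.of_nat (8 * m + 7) = 1727%num by lia.
have := small_factor_prime p_pr.
by have -> : N.of_nat (8 * m + 7) = 2239487%num by lia.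
Qed.

Theorem mainTheorem1 :
  (forall n : nat, 0 < n ->
     ((exists K : nat, forall k : nat, K <= k ->
         iter (k + 2) g n = 2 * iter k g n)
      <->
      (exists k : nat,
         let m := iter k g n in totient m + totient (m + totient m) = m)))
  /\
  (forall n : nat, 0 < n -> totient n + totient (n + totient n) = n ->
     exists l : nat, 1 <= l /\
       ( n \in [:: 2 ^ l * 1; 2 ^ l * 3; 2 ^ l * 5;
                   2 ^ l * 7; 2 ^ l * 35; 2 ^ l * 47]
       \/
         exists m : nat,
           [/\ prime (8 * m + 7),
               10 ^ 10 <= 8 * m + 7,
               totient (6 * m + 5) = 4 * m + 4
             & n = 2 ^ l * (8 * m + 7) \/ n = 2 ^ l * (6 * m + 5)])).
Proof.
split=> n n_gt0.
  have gg m : iter (m + 2) g n = g (g (iter m g n)) by rewrite addnC.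
  split=> [[K /(_ K (leqnn K)) EqK]|[K sol]].
    (* At a single index, [g (g m) = 2m] is already the totient equation for [m]. *)
    by exists K; move: EqK; rewrite gg /g /=; lia.
  have gt0 m : 0 < iter m g n by elim: m => //= m; rewrite /g; lia.
  exists K => k leKk; rewrite gg.
  suff: totient (iter k g n) + totient (g (iter k g n)) = iter k g n.
    by rewrite /g; lia.
  rewrite -(subnK leKk); elim: (k - K) => [|d IHd]; first exact: sol.
  by rewrite addSn; apply: g_solution (gt0 _) IHd.
move=> Eqn; have [l [l_gt0 cases_n]] := solution_classification n_gt0 Eqn.
exists l; split=> //; rewrite !inE.
case: cases_n => [->|[->|[m [p_pr def_t def_n]]]]; first by left; rewrite muln1 eqxx.
  by left; rewrite eqxx orbT.
have [le_p|lt_p] := leqP (10 ^ 10) (8 * m + 7); first by right; exists m.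
(* [m = 0] yields the odd parts 7 and 5, and [m = 5] yields 47 and 35. *)
left; case: (small_classification p_pr def_t lt_p) def_n => ->; case=> ->;
  by rewrite eqxx ?orbT.
Qed.
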